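(* Let $\Theta\vdash P::\Delta\rho$ and $\Theta',p:\Delta\vdash Q::\Gamma$ be derivable in CHOP, where $P$ and $Q$ are chop-free. Then there exists a chop-free process $R$ such that $\Theta,\Theta'\vdash R::\Gamma$ is derivable.
   Context: CHOP (Classical Higher-Order Processes). Channel names $x,y,z,\dots$; process variables $p,q,r$; parameter labels $l$ (constants); type variables $X$. A parameter record $\rho=\{l_1=x_1,\dots,l_k=x_k\}$ maps distinct labels to channel names. Processes: $P,Q,R ::= x[y].(P\mid Q)\mid x(y).P\mid x[\mathsf{inl}].P\mid x[\mathsf{inr}].P\mid x.\mathsf{case}(P,Q)\mid ?x[y].P\mid !x(y).P\mid x[A].P\mid x(X).P\mid x[\lambda\rho.P]$ (send the abstraction $\lambda\rho.P$, which binds the names in the image of $\rho$; that image must be exactly the free channel names of $P$) $\mid x(p).P$ (receive an abstraction into $p$, bound in $P$) $\mid p\langle\rho\rangle$ (run) $\mid x[\,]\mid x().P\mid x.\mathsf{case}()\mid x\leftrightarrow^A y$ (link) $\mid(\nu x^A y)(P\mid Q)$ (parallel composition, $x$ bound in $P$, $y$ in $Q$) $\mid \mathsf{let}\ p=\lambda\rho.Q\ \mathsf{in}\ P$ (explicit substitution, $p$ bound in $P$). In $x[y].(P\mid Q)$, $x(y).P$, $?x[y].P$, $!x(y).P$ the name $y$ is bound in the continuation $P$; in $x(X).P$, $X$ is bound. Processes are up to $\alpha$-equivalence. Session types: $A,B::=A\otimes B\mid A⅋B\mid A\oplus B\mid A\&B\mid 0\mid\top\mid1\mid\bot\mid ?A\mid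 !A\mid\exists X.A\mid\forall X.A\mid X\mid X^\perp\mid\mathsf{send}(\Gamma)\mid\mathsf{recv}(\Gamma)$, where a process type $\Gamma=s_1:A_1,\dots,s_n:A_n$ maps distinct keys (all labels or all channels) to session types, order irrelevant; $\Gamma,\Delta$ is the union of disjoint $\Gamma,\Delta$. Duality $A^\perp$: $(X)^\perp=X^\perp$, $(X^\perp)^\perp=X$, $\otimes/⅋$, $\oplus/\&$, $0/\top$, $1/\bot$, $?/!$, $\exists/\forall$ are swapped componentwise ($(A\otimes B)^\perp=A^\perp⅋B^\perp$, $(?A)^\perp=!(A^\perp)$, $(\exists X.A)^\perp=\forall X.A^\perp$, etc.), and $\mathsf{send}(\Gamma)^\perp=\mathsf{recv}(\Gamma)$, $\mathsf{recv}(\Gamma)^\perp=\mathsf{send}(\Gamma)$. $\Gamma\rho$ is $\Gamma$ with each label $l$ replaced by $\rho(l)$; $?\Gamma$ means every type in $\Gamma$ has the form $?A$. A process environment $\Theta=p_1:\Gamma_1,\dots,p_n:\Gamma_n$ has distinct variables; $\cdot$ is empty. Typing rules for $\Theta\vdash P::\Gamma$: (Axiom) $\cdot\vdash x\leftrightarrow^A y::x:A^\perp,y:A$. (Cut) $\Theta\vdash P::\Gamma,x:A$ and $\Theta'\vdash Q::\Delta,y:A^\perp$ give $\Theta,\Theta'\vdash(\nu x^Ay)(P\mid Q)::\Gamma,\Delta$. ($\otimes$) $\Theta\vdash P::\Gamma,y:A$ and $\Theta'\vdash Q::\Delta,x:B$ give $\Theta,\Theta'\vdash x[y].(P\mid Q)::\Gamma,\Delta,x:A\otimes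 B$. ($⅋$) $\Theta\vdash P::\Gamma,y:A,x:B$ gives $\Theta\vdash x(y).P::\Gamma,x:A⅋B$. ($\oplus_1$,$\oplus_2$) $\Theta\vdash P::\Gamma,x:A$ (resp. $x:B$) gives $\Theta\vdash x[\mathsf{inl}].P$ (resp. $x[\mathsf{inr}].P$) $::\Gamma,x:A\oplus B$. ($\&$) $\Theta\vdash P::\Gamma,x:A$ and $\Theta\vdash Q::\Gamma,x:B$ give $\Theta\vdash x.\mathsf{case}(P,Q)::\Gamma,x:A\&B$. ($?$) $\Theta\vdash P::\Gamma,y:A$ gives $\Theta\vdash ?x[y].P::\Gamma,x:?A$. ($!$) $\cdot\vdash P::?\Gamma,y:A$ gives $\cdot\vdash !x(y).P::?\Gamma,x:!A$. ($\exists$) $\Theta\vdash P::\Gamma,x:B\{A/X\}$ gives $\Theta\vdash x[A].P::\Gamma,x:\exists X.B$. ($\forall$) $\Theta\vdash P::\Gamma,x:B$, $X$ not free in $\Theta,\Gamma$, gives $\Theta\vdash x(X).P::\Gamma,x:\forall X.B$. (Weaken) $\Theta\vdash P::\Gamma$ gives $\Theta\vdash P::\Gamma,x:?A$. (Contract) $\Theta\vdash P::\Gamma,y:?A,z:?A$ gives $\Theta\vdash P\{x/y,x/z\}::\Gamma,x:?A$. ($1$) $\cdot\vdash x[\,]::x:1$. ($\bot$) $\Theta\vdash P::\Gamma$ gives $\Theta\vdash x().P::\Gamma,x:\bot$. ($\top$) $\Theta\vdash x.\mathsf{case}()::\Gamma,x:\top$. (No rule for $0$.) (Id) $p:\Gamma\vdash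 p\langle\rho\rangle::\Gamma\rho$. (Chop) $\Theta\vdash P::\Delta\rho$ and $\Theta',p:\Delta\vdash Q::\Gamma$ give $\Theta,\Theta'\vdash\mathsf{let}\ p=\lambda\rho.P\ \mathsf{in}\ Q::\Gamma$. ($\mathsf{send}$) $\Theta\vdash P::\Gamma\rho$ gives $\Theta\vdash x[\lambda\rho.P]::x:\mathsf{send}(\Gamma)$. ($\mathsf{recv}$) $\Theta,p:\Delta\vdash P::\Gamma$ gives $\Theta\vdash x(p).P::\Gamma,x:\mathsf{recv}(\Delta)$. A process is chop-free if its typing derivation contains no application of rule Chop. *)

(* Defs.v *)
From mathcomp Require Import all_boot finmap.

Set Implicit Arguments.
Unset Strict Implicit.
Unset Printing Implicit Defensive.

Local Open Scope fset_scope.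
Local Open Scope fmap_scope.

(** Classical Higher-Order Processes.

    Types and processes are taken up to alpha-equivalence by means of nested
    (well-scoped) datatypes: the parameters [C], [V], [T] of [proc] are the
    types of channel names, process variables and type variables in scope, and
    a binder extends the relevant one with [option], [None] being the bound
    name.  Leibniz equality is then alpha-equivalence.  The functions [bindC],
    [bindV], [bindT], [tbind] turn a body written with a named variable into
    the body of a binder, so that, e.g., [PRecv x (bindC y P)] is the
    alpha-class of x(y).P.

    Process types and process environments are finite maps [{fmap K -> _}], so
    that keys are distinct and order is irrelevant.  [G.[x <- A]] together with
    [x \notin domf G] stands for "G, x : A", and [G + D] together with
    disjointness of the domains stands for "G, D". *)

Definition chan := nat.
Definition label := nat.
Definition pvar := nat.
Definition tvar := nat.

Definition fmap_map (K : choiceType) (A B : Type) (f : A -> B)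
    (m : {fmap K -> A}) : {fmap K -> B} :=
  [fmap k : domf m => f (m k)].

(** ** Session types *)

Inductive styp (V : Type) : Type :=
| TTensor of styp V & styp V
| TPar of styp V & styp V
| TPlus of styp V & styp V
| TWith of styp V & styp V
| TZero
| TTop
| TOne
| TBot
| TQuest of styp V
| TBang of styp V
| TExists of styp (option V)
| TForall of styp (option V)
| TVar of V
| TDualVar of V
| TSend of {fmap label -> styp V}
| TRecv of {fmap label -> styp V}.

Arguments TZero {V}.
Arguments TTop {V}.
Arguments TOne {V}.
Arguments TBot {V}.

Fixpoint dual (V : Type) (A : styp V) : styp V :=
  match A with
  | TTensor A B => TPar (dual A) (dual B)
  | TPar A B => TTensor (dual A) (dual B)
  | TPlus A B => TWith (dual A) (dual B)
  | TWith A B => TPlus (dual A) (dual B)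
  | TZero => TTop
  | TTop => TZero
  | TOne => TBot
  | TBot => TOne
  | TQuest A => TBang (dual A)
  | TBang A => TQuest (dual A)
  | TExists B => TForall (dual B)
  | TForall B => TExists (dual B)
  | TVar X => TDualVar X
  | TDualVar X => TVar X
  | TSend G => TRecv G
  | TRecv G => TSend G
  end.

Fixpoint styp_map (V W : Type) (f : V -> W) (A : styp V) : styp W :=
  match A with
  | TTensor A B => TTensor (styp_map f A) (styp_map f B)
  | TPar A B => TPar (styp_map f A) (styp_map f B)
  | TPlus A B => TPlus (styp_map f A) (styp_map f B)
  | TWith A B => TWith (styp_map f A) (styp_map f B)
  | TZero => TZero
  | TTop => TTop
  | TOne => TOne
  | TBot => TBot
  | TQuest A => TQuest (styp_map f A)
  | TBang A => TBang (styp_map f A)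
  | TExists B => TExists (styp_map (omap f) B)
  | TForall B => TForall (styp_map (omap f) B)
  | TVar X => TVar (f X)
  | TDualVar X => TDualVar (f X)
  | TSend G => TSend (fmap_map (styp_map f) G)
  | TRecv G => TRecv (fmap_map (styp_map f) G)
  end.

Definition lift_subst (V W : Type) (f : V -> styp W) (o : option V) :
    styp (option W) :=
  if o is Some X then styp_map Some (f X) else TVar None.

Fixpoint styp_subst (V W : Type) (f : V -> styp W) (A : styp V) : styp W :=
  match A with
  | TTensor A B => TTensor (styp_subst f A) (styp_subst f B)
  | TPar A B => TPar (styp_subst f A) (styp_subst f B)
  | TPlus A B => TPlus (styp_subst f A) (styp_subst f B)
  | TWith A B => TWith (styp_subst f A) (styp_subst f B)
  | TZero => TZero
  | TTop => TTop
  | TOne => TOne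
  | TBot => TBot
  | TQuest A => TQuest (styp_subst f A)
  | TBang A => TBang (styp_subst f A)
  | TExists B => TExists (styp_subst (lift_subst f) B)
  | TForall B => TForall (styp_subst (lift_subst f) B)
  | TVar X => f X
  | TDualVar X => dual (f X)
  | TSend G => TSend (fmap_map (styp_subst f) G)
  | TRecv G => TRecv (fmap_map (styp_subst f) G)
  end.

Fixpoint tfree (V : Type) (X : V) (A : styp V) : Prop :=
  match A with
  | TTensor A B | TPar A B | TPlus A B | TWith A B => tfree X A \/ tfree X B
  | TZero | TTop | TOne | TBot => False
  | TQuest A | TBang A => tfree X A
  | TExists B | TForall B => tfree (Some X) B
  | TVar Y | TDualVar Y => X = Y
  | TSend G | TRecv G => exists l : domf G, tfree X (G l)
  end.

Definition sty := styp tvar.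

Definition abs_var (n m : nat) : option nat := if m == n then None else Some m.

(** [TExists (tbind X B)] is "exists X. B". *)
Definition tbind (X : tvar) (B : sty) : styp (option tvar) :=
  styp_map (abs_var X) B.

(** B{A/X} *)
Definition tsubst (X : tvar) (A B : sty) : sty :=
  styp_subst (fun Y => if Y == X then A else TVar Y) B.

(** ** Process types, environments and parameter records *)

(** Process types keyed by labels (in types and process environments) and by
    channels (in typing judgements). *)
Definition ltype := {fmap label -> sty}.
Definition ctype := {fmap chan -> sty}.
Definition penv := {fmap pvar -> ltype}.
Definition record := {fmap label -> chan}.

Definition tfree_map (K : choiceType) (X : tvar) (G : {fmap K -> sty}) : Prop :=
  exists k A, G.[? k] = Some A /\ tfree X A.

Definition tfree_env (X : tvar) (E : penv) : Prop :=
  exists p D, E.[? p] = Some D /\ tfree_map X D.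

Definition all_quest (G : ctype) : Prop :=
  forall x A, G.[? x] = Some A -> exists B, A = TQuest B.

(** [relabel D r G]: "D r" is defined and equal to [G].  It is defined when [r]
    assigns channels to exactly the labels of [D], distinct ones since the keys
    of [G] are distinct. *)
Definition relabel (D : ltype) (r : record) (G : ctype) : Prop :=
  [/\ domf r = domf D,
      injective r,
      domf G = codomf r
    & forall l x, r.[? l] = Some x -> G.[? x] = D.[? l]].

(** ** Processes *)

(** In [PSend x r P] (for x[\r.P]) and [PLet r Q P] (for let p = \r.Q in P) the
    names bound by the abstraction are represented by labels: a channel
    [inl l] of the body is the bound name represented by [l], a channel [inr x]
    is the channel [x] of the enclosing scope, and [r] sends each parameter
    label to the representative of its bound name.  See [bindR], [params]. *)
Inductive proc (C V T : Type) : Type :=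
| PTensor of C & proc (option C) V T & proc C V T       (* x[y].(P | Q) *)
| PRecv of C & proc (option C) V T                      (* x(y).P *)
| PInl of C & proc C V T                                (* x[inl].P *)
| PInr of C & proc C V T                                (* x[inr].P *)
| PCase of C & proc C V T & proc C V T                  (* x.case(P, Q) *)
| PQuest of C & proc (option C) V T                     (* ?x[y].P *)
| PBang of C & proc (option C) V T                      (* !x(y).P *)
| PSendT of C & styp T & proc C V T                     (* x[A].P *)
| PRecvT of C & proc C V (option T)                     (* x(X).P *)
| PSend of C & {fmap label -> label} & proc (label + C) V T  (* x[\r.P] *)
| PRecvP of C & proc C (option V) T                     (* x(p).P *)
| PRun of V & {fmap label -> C}                         (* p<r> *)
| PClose of C                                           (* x[] *)
| PWait of C & proc C V T                               (* x().P *)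
| PCase0 of C                                           (* x.case() *)
| PLink of styp T & C & C                               (* x <->^A y *)
| PCut of styp T & proc (option C) V T & proc (option C) V T
                                                        (* (nu x^A y)(P | Q) *)
| PLet of {fmap label -> label} & proc (label + C) V T & proc C (option V) T.
                                                        (* let p = \r.Q in P *)

Arguments PClose {C V T}.
Arguments PCase0 {C V T}.
Arguments PLink {C V T}.
Arguments PRun {C V T}.

Definition sum_mapr (L C C' : Type) (f : C -> C') (u : L + C) : L + C' :=
  match u with inl l => inl l | inr x => inr (f x) end.

Fixpoint proc_map (C C' V V' T T' : Type) (f : C -> C') (g : V -> V')
    (h : T -> T') (P : proc C V T) : proc C' V' T' :=
  match P with
  | PTensor x P Q =>
      PTensor (f x) (proc_map (omap f) g h P) (proc_map f g h Q)
  | PRecv x P => PRecv (f x) (proc_map (omap f) g h P)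
  | PInl x P => PInl (f x) (proc_map f g h P)
  | PInr x P => PInr (f x) (proc_map f g h P)
  | PCase x P Q => PCase (f x) (proc_map f g h P) (proc_map f g h Q)
  | PQuest x P => PQuest (f x) (proc_map (omap f) g h P)
  | PBang x P => PBang (f x) (proc_map (omap f) g h P)
  | PSendT x A P => PSendT (f x) (styp_map h A) (proc_map f g h P)
  | PRecvT x P => PRecvT (f x) (proc_map f g (omap h) P)
  | PSend x r P => PSend (f x) r (proc_map (sum_mapr f) g h P)
  | PRecvP x P => PRecvP (f x) (proc_map f (omap g) h P)
  | PRun p r => PRun (g p) (fmap_map f r)
  | PClose x => PClose (f x)
  | PWait x P => PWait (f x) (proc_map f g h P)
  | PCase0 x => PCase0 (f x)
  | PLink A x y => PLink (styp_map h A) (f x) (f y)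
  | PCut A P Q =>
      PCut (styp_map h A) (proc_map (omap f) g h P) (proc_map (omap f) g h Q)
  | PLet r Q P =>
      PLet r (proc_map (sum_mapr f) g h Q) (proc_map f (omap g) h P)
  end.

(** Free channel names. *)
Fixpoint cfree (C V T : Type) (z : C) (P : proc C V T) : Prop :=
  match P with
  | PTensor x P Q => [\/ z = x, cfree (Some z) P | cfree z Q]
  | PRecv x P | PQuest x P | PBang x P => z = x \/ cfree (Some z) P
  | PInl x P | PInr x P | PSendT x _ P | PWait x P => z = x \/ cfree z P
  | PCase x P Q => [\/ z = x, cfree z P | cfree z Q]
  | PRecvT x P => z = x \/ cfree z P
  | PSend x _ P => z = x \/ cfree (inr z) P
  | PRecvP x P => z = x \/ cfree z P
  | PRun _ r => exists l, r.[? l] = Some z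
  | PClose x | PCase0 x => z = x
  | PLink _ x y => z = x \/ z = y
  | PCut _ P Q => cfree (Some z) P \/ cfree (Some z) Q
  | PLet _ Q P => cfree (inr z) Q \/ cfree z P
  end.

Definition process := proc chan pvar tvar.

Definition bindC (y : chan) (P : process) : proc (option chan) pvar tvar :=
  proc_map (abs_var y) id id P.

Definition bindV (p : pvar) (P : process) : proc chan (option pvar) tvar :=
  proc_map id (abs_var p) id P.

Definition bindT (X : tvar) (P : process) : proc chan pvar (option tvar) :=
  proc_map id id (abs_var X) P.

(** The label representing the name [x] of the image of [r]: some [l] with
    [r l = x], chosen as a function of [domf r] and of the set of all such
    labels only, whence alpha-invariance. *)
Definition label_of (r : record) (x : chan) : option label :=
  omap val [pick l : domf r | r l == x].

Definition params (r : record) : {fmap label -> label} :=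
  [fmap l : domf r => odflt (val l) (label_of r (r l))].

(** [PSend x (params r) (bindR r P)] is x[\r.P]. *)
Definition bindR (r : record) (P : process) : proc (label + chan) pvar tvar :=
  proc_map (fun x => if label_of r x is Some l then inl l else inr x) id id P.

(** Side condition on the syntax of abstractions \r.P: the image of [r] is
    exactly the set of free channel names of [P]. *)
Definition abs_ok (r : record) (P : process) : Prop :=
  forall x, cfree x P <-> x \in codomf r.

(** P{x/y, x/z} *)
Definition contract (x y z : chan) (P : process) : process :=
  proc_map (fun w => if (w == y) || (w == z) then x else w) id id P.

(** ** Typing derivations *)

(** [typing E P G] is the type of derivations of E |- P :: G; it lives in [Type]
    so that the rules used in a derivation can be inspected. *)
Inductive typing : penv -> process -> ctype -> Type :=
| ty_axiom (A : sty) (x y : chan) :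
    x != y ->
    typing [fmap] (PLink A x y) [fmap].[x <- dual A].[y <- A]
| ty_cut (E E' : penv) (P Q : process) (G D : ctype) (A : sty) (x y : chan) :
    x \notin domf G -> y \notin domf D ->
    [disjoint domf G & domf D] -> [disjoint domf E & domf E'] ->
    typing E P G.[x <- A] ->
    typing E' Q D.[y <- dual A] ->
    typing (E + E') (PCut A (bindC x P) (bindC y Q)) (G + D)
| ty_tensor (E E' : penv) (P Q : process) (G D : ctype) (A B : sty)
      (x y : chan) :
    y \notin domf G -> x \notin domf G -> x \notin domf D ->
    [disjoint domf G & domf D] -> [disjoint domf E & domf E'] ->
    typing E P G.[y <- A] ->
    typing E' Q D.[x <- B] ->
    typing (E + E') (PTensor x (bindC y P) Q) (G + D).[x <- TTensor A B]
| ty_par (E : penv) (P : process) (G : ctype) (A B : sty) (x y : chan) :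
    y \notin domf G -> x \notin domf G -> x != y ->
    typing E P G.[y <- A].[x <- B] ->
    typing E (PRecv x (bindC y P)) G.[x <- TPar A B]
| ty_plus1 (E : penv) (P : process) (G : ctype) (A B : sty) (x : chan) :
    x \notin domf G ->
    typing E P G.[x <- A] ->
    typing E (PInl x P) G.[x <- TPlus A B]
| ty_plus2 (E : penv) (P : process) (G : ctype) (A B : sty) (x : chan) :
    x \notin domf G ->
    typing E P G.[x <- B] ->
    typing E (PInr x P) G.[x <- TPlus A B]
| ty_with (E : penv) (P Q : process) (G : ctype) (A B : sty) (x : chan) :
    x \notin domf G ->
    typing E P G.[x <- A] ->
    typing E Q G.[x <- B] ->
    typing E (PCase x P Q) G.[x <- TWith A B]
| ty_quest (E : penv) (P : process) (G : ctype) (A : sty) (x y : chan) :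
    y \notin domf G -> x \notin domf G ->
    typing E P G.[y <- A] ->
    typing E (PQuest x (bindC y P)) G.[x <- TQuest A]
| ty_bang (P : process) (G : ctype) (A : sty) (x y : chan) :
    y \notin domf G -> x \notin domf G -> all_quest G ->
    typing [fmap] P G.[y <- A] ->
    typing [fmap] (PBang x (bindC y P)) G.[x <- TBang A]
| ty_exists (E : penv) (P : process) (G : ctype) (A B : sty) (X : tvar)
      (x : chan) :
    x \notin domf G ->
    typing E P G.[x <- tsubst X A B] ->
    typing E (PSendT x A P) G.[x <- TExists (tbind X B)]
| ty_forall (E : penv) (P : process) (G : ctype) (B : sty) (X : tvar)
      (x : chan) :
    x \notin domf G -> ~ tfree_env X E -> ~ tfree_map X G ->
    typing E P G.[x <- B] ->
    typing E (PRecvT x (bindT X P)) G.[x <- TForall (tbind X B)]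
| ty_weaken (E : penv) (P : process) (G : ctype) (A : sty) (x : chan) :
    x \notin domf G ->
    typing E P G ->
    typing E P G.[x <- TQuest A]
| ty_contract (E : penv) (P : process) (G : ctype) (A : sty) (x y z : chan) :
    y \notin domf G -> z \notin domf G -> y != z -> x \notin domf G ->
    typing E P G.[y <- TQuest A].[z <- TQuest A] ->
    typing E (contract x y z P) G.[x <- TQuest A]
| ty_one (x : chan) :
    typing [fmap] (PClose x) [fmap].[x <- TOne]
| ty_bot (E : penv) (P : process) (G : ctype) (x : chan) :
    x \notin domf G ->
    typing E P G ->
    typing E (PWait x P) G.[x <- TBot]
| ty_top (E : penv) (G : ctype) (x : chan) :
    x \notin domf G ->
    typing E (PCase0 x) G.[x <- TTop]
| ty_id (p : pvar) (D : ltype) (r : record) (G : ctype) :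
    relabel D r G ->
    typing [fmap].[p <- D] (PRun p r) G
| ty_chop (E E' : penv) (P Q : process) (D : ltype) (r : record) (G' G : ctype)
      (p : pvar) :
    p \notin domf E' -> [disjoint domf E & domf E'] ->
    abs_ok r P -> relabel D r G' ->
    typing E P G' ->
    typing E'.[p <- D] Q G ->
    typing (E + E') (PLet (params r) (bindR r P) (bindV p Q)) G
| ty_send (E : penv) (P : process) (D : ltype) (r : record) (G : ctype)
      (x : chan) :
    abs_ok r P -> relabel D r G ->
    typing E P G ->
    typing E (PSend x (params r) (bindR r P)) [fmap].[x <- TSend D]
| ty_recv (E : penv) (P : process) (D : ltype) (G : ctype) (x : chan)
      (p : pvar) :
    p \notin domf E -> x \notin domf G ->
    typing E.[p <- D] P G ->
    typing E (PRecvP x (bindV p P)) G.[x <- TRecv D].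

Fixpoint chop_free (E : penv) (P : process) (G : ctype) (d : typing E P G) :
    Prop :=
  match d with
  | ty_chop _ _ _ _ _ _ _ _ _ _ _ _ _ _ _ => False
  | ty_axiom _ _ _ _ | ty_one _ | ty_top _ _ _ _ | ty_id _ _ _ _ _ => True
  | ty_cut _ _ _ _ _ _ _ _ _ _ _ _ _ d1 d2 => chop_free d1 /\ chop_free d2
  | ty_tensor _ _ _ _ _ _ _ _ _ _ _ _ _ _ _ d1 d2 =>
      chop_free d1 /\ chop_free d2
  | ty_with _ _ _ _ _ _ _ _ d1 d2 => chop_free d1 /\ chop_free d2
  | ty_par _ _ _ _ _ _ _ _ _ _ d1 => chop_free d1
  | ty_plus1 _ _ _ _ _ _ _ d1 => chop_free d1
  | ty_plus2 _ _ _ _ _ _ _ d1 => chop_free d1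
  | ty_quest _ _ _ _ _ _ _ _ d1 => chop_free d1
  | ty_bang _ _ _ _ _ _ _ _ d1 => chop_free d1
  | ty_exists _ _ _ _ _ _ _ _ d1 => chop_free d1
  | ty_forall _ _ _ _ _ _ _ _ _ d1 => chop_free d1
  | ty_weaken _ _ _ _ _ _ d1 => chop_free d1
  | ty_contract _ _ _ _ _ _ _ _ _ _ _ d1 => chop_free d1
  | ty_bot _ _ _ _ _ d1 => chop_free d1
  | ty_send _ _ _ _ _ _ _ _ d1 => chop_free d1
  | ty_recv _ _ _ _ _ _ _ _ d1 => chop_free d1
  end.

(* Main.v *)
(** Chop is a [send]/[recv] cut in disguise: with a fresh channel x,
    let p = \r.P in Q is simulated by (nu x y)(x[\r.P] | y(p).Q), whose
    derivation uses only Cut, send and recv on top of those of P and Q.  The one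
    obstacle is the side condition of send, that every name of the type of P be
    free in P, which may fail because of Weaken and of the rule for top.  It is
    restored by forwarding: cutting P on a name x : A against a link between
    the dual end and x gives a process of the same type in which x is free. *)
Require Import Defs.
From Stdlib Require Import Setoid.
From mathcomp Require Import all_boot finmap.

Set Implicit Arguments.
Unset Strict Implicit.
Unset Printing Implicit Defensive.

Local Open Scope fset_scope.
Local Open Scope fmap_scope.

(** * Free channel names under renaming and binding *)

Definition img (C C' : Type) (f : C -> C') (S : C -> Prop) (z : C') : Prop :=
  exists2 w, S w & z = f w.

Lemma img_omap (C C' : Type) (f : C -> C') (S : option C -> Prop) (z : C') :
  img (omap f) S (Some z) <-> img f (fun w => S (Some w)) z.
Proof.
by split=> [[[w|] Sw] //= [->]|[w Sw ->]]; [exists w | exists (Some w)].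
Qed.

Lemma img_sum_mapr (L C C' : Type) (f : C -> C') (S : L + C -> Prop)
    (z : C') :
  img (sum_mapr f) S (inr z) <-> img f (fun w => S (inr w)) z.
Proof.
by split=> [[[l|w] Sw] //= [->]|[w Sw ->]]; [exists w | exists (inr w)].
Qed.

Lemma img_or (C C' : Type) (f : C -> C') (S S' : C -> Prop) (z : C') :
  img f (fun w => S w \/ S' w) z <-> img f S z \/ img f S' z.
Proof.
split=> [[w [] Sw ->]|[] [w Sw ->]].
- by left; exists w.
- by right; exists w.
- by exists w => //; left.
- by exists w => //; right.
Qed.

Lemma or3_or (P Q S : Prop) : [\/ P, Q | S] <-> P \/ Q \/ S.
Proof.
by split=> [[] HP|[HP|[HP|HP]]]; [left | right; left | right; right
  | constructor 1 | constructor 2 | constructor 3].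
Qed.

Lemma img_or3 (C C' : Type) (f : C -> C') (S S' S'' : C -> Prop) (z : C') :
  img f (fun w => [\/ S w, S' w | S'' w]) z <->
  img f S z \/ img f S' z \/ img f S'' z.
Proof.
by rewrite -!img_or; split=> -[w /or3_or Sw ->]; exists w.
Qed.

Lemma img_eq (C C' : Type) (f : C -> C') (x : C) (z : C') :
  img f (fun w => w = x) z <-> z = f x.
Proof. by split=> [[w ->]|->] //; exists x. Qed.

Lemma img_fmap_map (K : choiceType) (C C' : Type) (f : C -> C')
    (r : {fmap K -> C}) (z : C') :
  (exists l, (fmap_map f r).[? l] = Some z) <->
  img f (fun w => exists l, r.[? l] = Some w) z.
Proof.
have fE l : (fmap_map f r).[? l] = omap f r.[? l].
  case: fndP => [lr|lNr]; last by rewrite [r.[? l]]not_fnd.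
  by rewrite ffunE [r.[? l]]in_fnd.
split=> [[l]|[w [l rl] ->]]; last by exists l; rewrite fE rl.
by rewrite fE; case rl: (r.[? l]) => [w|] //= [<-]; exists w => //; exists l.
Qed.

(** Lifted maps send bound names to bound names only, so below a binder the image is determined by
    the outer names. The maps are quantified after [P] because their scopes change under binders. *)
Lemma cfree_proc_map (C V T : Type) (P : proc C V T) :
  forall (C' V' T' : Type) (f : C -> C') (g : V -> V') (h : T -> T') (z : C'),
  cfree z (proc_map f g h P) <-> img f (fun w => cfree w P) z.
Proof.
move: C V T P; apply: proc_ind => /=; intros;
  rewrite ?img_or3 ?img_or ?img_eq ?or3_or;
  repeat match goal with H : context [proc_map] |- _ => rewrite {}H end;
  rewrite ?img_omap ?img_sum_mapr //.
exact: img_fmap_map.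
Qed.

Lemma cfree_bindC (y z : chan) (P : process) :
  cfree (Some z) (bindC y P) <-> z != y /\ cfree z P.
Proof.
rewrite /bindC cfree_proc_map /abs_var; split.
  by case=> w Pw; case: eqP => // /eqP wy [->].
by case=> /negPf zy Pz; exists z; rewrite ?zy.
Qed.

Lemma cfree_bindV (p : pvar) (z : chan) (P : process) :
  cfree z (bindV p P) <-> cfree z P.
Proof.
by rewrite /bindV cfree_proc_map; split=> [[w Pw ->]|Pz] //; exists z.
Qed.

Lemma cfree_bindT (X : tvar) (z : chan) (P : process) :
  cfree z (bindT X P) <-> cfree z P.
Proof.
by rewrite /bindT cfree_proc_map; split=> [[w Pw ->]|Pz] //; exists z.
Qed.

(** By [abs_ok], every free name of [P] has a label in [r], hence is sent to some [inl]. *)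
Lemma cfree_bindR (r : record) (z : chan) (P : process) :
  abs_ok r P -> ~ cfree (inr z) (bindR r P).
Proof.
move=> rP /cfree_proc_map [w /rP /codomfP [l rl]].
(* Failure of [pick] is refuted by [l] itself. *)
rewrite /label_of; case: pickP => //= none _.
by case: fndP rl => // lr [rl]; move: (none [` lr]); rewrite rl eqxx.
Qed.

(** * Free names and the domain of the type *)

Lemma in_domf_set (K : choiceType) (V : Type) (f : {fmap K -> V}) (k k' : K)
    (v : V) :
  (k' \in domf f.[k <- v]) = (k' == k) || (k' \in domf f).
Proof. exact: mem_setf. Qed.

Lemma in_domf_cat (K : choiceType) (V : Type) (f g : {fmap K -> V}) (k : K) :
  (k \in domf (f + g)) = (k \in domf f) || (k \in domf g).
Proof. exact: mem_catf. Qed.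

(** Each rule removes from the type only names that its process binds or renames. This is the half
    of the send side condition that holds for every derivation. *)
Lemma cfree_dom (E : penv) (P : process) (G : ctype) (z : chan) :
  typing E P G -> cfree z P -> z \in domf G.
Proof.
move=> d; elim: d z => {E P G}.
- by move=> A x y _ z [] ->; rewrite !in_domf_set eqxx ?orbT.
- move=> E E' P Q G D A x y _ _ _ _ _ IHP _ IHQ z.
  rewrite in_domf_cat => -[] /cfree_bindC [/negPf zx].
    by move=> /IHP; rewrite in_domf_set zx /= => ->.
  by move=> /IHQ; rewrite in_domf_set zx /= => ->; rewrite orbT.
- move=> E E' P Q G D A B x y _ _ _ _ _ _ IHP _ IHQ z.
  rewrite in_domf_set in_domf_cat.
  case=> [->|/cfree_bindC [/negPf zy /IHP]|/IHQ].
  + by rewrite eqxx.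
  + by rewrite in_domf_set zy /= => ->; rewrite orbT.
  + by rewrite in_domf_set => /orP[->//|->]; rewrite !orbT.
- move=> E P G A B x y _ _ _ _ IHP z; rewrite in_domf_set.
  case=> [->|/cfree_bindC [/negPf zy /IHP]]; first by rewrite eqxx.
  by rewrite !in_domf_set zy.
- move=> E P G A B x _ _ IHP z; rewrite in_domf_set.
  by case=> [->|/IHP]; rewrite ?eqxx ?in_domf_set.
- move=> E P G A B x _ _ IHP z; rewrite in_domf_set.
  by case=> [->|/IHP]; rewrite ?eqxx ?in_domf_set.
- move=> E P Q G A B x _ _ IHP _ IHQ z; rewrite in_domf_set.
  by case=> [->|/IHP|/IHQ]; rewrite ?eqxx ?in_domf_set.
- move=> E P G A x y _ _ _ IHP z; rewrite in_domf_set.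
  case=> [->|/cfree_bindC [/negPf zy /IHP]]; first by rewrite eqxx.
  by rewrite in_domf_set zy /= => ->; rewrite orbT.
- move=> P G A x y _ _ _ _ IHP z; rewrite in_domf_set.
  case=> [->|/cfree_bindC [/negPf zy /IHP]]; first by rewrite eqxx.
  by rewrite in_domf_set zy /= => ->; rewrite orbT.
- move=> E P G A B X x _ _ IHP z; rewrite in_domf_set.
  by case=> [->|/IHP]; rewrite ?eqxx ?in_domf_set.
- move=> E P G B X x _ _ _ _ IHP z; rewrite in_domf_set.
  by case=> [->|/cfree_bindT /IHP]; rewrite ?eqxx ?in_domf_set.
- move=> E P G A x _ _ IHP z /IHP; rewrite in_domf_set => ->.
  by rewrite orbT.
- move=> E P G A x y z _ _ _ _ _ IHP w /cfree_proc_map [v /IHP].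
  (* Contraction: [y] and [z] become [x]; any other free name is fixed and lies in [domf G]. *)
  rewrite !in_domf_set => vG ->; case: ifP => [|vyz]; first by rewrite eqxx.
  by move: vG; rewrite orbA (orbC (v == z)) vyz /= => ->; rewrite orbT.
- by move=> x z ->; rewrite in_domf_set eqxx.
- move=> E P G x _ _ IHP z; rewrite in_domf_set.
  by case=> [->|/IHP ->]; rewrite ?eqxx ?orbT.
- by move=> E G x _ z ->; rewrite in_domf_set eqxx.
- by move=> p D r G [_ _ eG _] z /codomfP; rewrite eG.
- move=> E E' P Q D r G' G p _ _ rP _ _ _ _ IHQ z.
  by case=> [/(cfree_bindR rP)|/cfree_bindV /IHQ].
- move=> E P D r G x rP _ _ _ z.
  by case=> [->|/(cfree_bindR rP)//]; rewrite in_domf_set eqxx.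
- move=> E P D G x p _ _ _ IHP z; rewrite in_domf_set.
  by case=> [->|/cfree_bindV /IHP ->]; rewrite ?eqxx ?orbT.
Qed.

(** * Forwarding *)

Definition chop_free_typable (E : penv) (P : process) (G : ctype) : Prop :=
  exists d : typing E P G, chop_free d.

Lemma cut_chop_free (E E' : penv) (P Q : process) (G D : ctype) (A : sty)
    (x y : chan) :
  x \notin domf G -> y \notin domf D ->
  [disjoint domf G & domf D] -> [disjoint domf E & domf E'] ->
  chop_free_typable E P G.[x <- A] ->
  chop_free_typable E' Q D.[y <- dual A] ->
  chop_free_typable (E + E') (PCut A (bindC x P) (bindC y Q)) (G + D).
Proof.
by move=> xG yD GD EE' [d cd] [d' cd']; exists (ty_cut xG yD GD EE' d d').
Qed.

(** The cut binds the old [x], and the outer end of the link provides a new one at the same type.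
    The last clause allows iteration over several names. *)
Lemma forward (E : penv) (P : process) (G : ctype) (x : chan) :
  x \in domf G -> chop_free_typable E P G ->
  exists P', [/\ chop_free_typable E P' G, cfree x P'
    & forall z, cfree z P -> cfree z P'].
Proof.
(* [y] is bound by the cut, so it only has to differ from [x]. *)
move=> xG PG; set A := G.[xG]; set y := x.+1.
have xy : x != y by rewrite neq_ltn ltnSn.
have GA : G.[x <- A] = G := setf_get [` xG].
have GE : G.[~ x] + [fmap].[x <- A] = G.
  by rewrite catf_setr catf0 setf_rem1 GA.
have xGx : x \notin domf G.[~ x] by rewrite mem_remf1 eqxx.
exists (PCut A (bindC x P) (bindC y (PLink A y x))); split; first 1 last.
- by right; apply/cfree_bindC; split=> //; right.
- move=> z Pz; have [->|zx] := eqVneq z x.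
    by right; apply/cfree_bindC; split=> //; right.
  by left; apply/cfree_bindC.
(* The link contributes the empty environment and the singleton [x : A]. Hiding the derivation under
   an existential lets both contexts be rewritten directly. *)
- rewrite -[E]catf0 -GE; apply: cut_chop_free => //.
  + by rewrite in_domf_set in_fset0 orbF eq_sym.
  + by rewrite dom_setf fsetU0 fdisjointX1.
  + exact: fdisjointX0.
  + by rewrite setf_rem1 GA.
  (* The axiom inserts [y] first; distinct keys commute. *)
  + rewrite setfC eq_sym (negPf xy).
    have yx : y != x by rewrite eq_sym.
    by exists (ty_axiom A yx).
Qed.

(** Forwarding each key of [G] in turn makes all of them free; [cfree_dom] excludes any other
    name. *)
Lemma forward_all (E : penv) (P : process) (G : ctype) :
  chop_free_typable E P G ->
  exists P', chop_free_typable E P' G /\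
    forall z, cfree z P' <-> z \in domf G.
Proof.
move=> PG.
have [P' [P'G P'free]] : exists P', chop_free_typable E P' G /\
    forall z, z \in (domf G : seq chan) -> cfree z P'.
  (* Induction on the list of keys, with its inclusion in [domf G] kept so that [forward] applies to
     each entry. *)
  have: {subset (domf G : seq chan) <= domf G} by [].
  elim: (domf G : seq chan) => [|x s IHs] sG; first by exists P.
  have [|P1 [P1G P1free]] := IHs.
    by move=> z zs; apply: sG; rewrite inE zs orbT.
  have [P2 [P2G xP2 P2free]] := forward (sG x (mem_head x s)) P1G.
  exists P2; split=> // z; rewrite inE => /predU1P[->//|/P1free].
  exact: P2free.
exists P'; split=> // z; split=> [|/P'free//].
by case: P'G => d _; apply: cfree_dom d.
Qed.

(** * Simulating Chop by Cut *)

Lemma fresh (s : seq nat) : exists x, x \notin s.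
Proof.
exists (\max_(k <- s) k).+1; apply/negP => xs.
by have:= @leq_bigmax_seq _ s xpredT id _ xs isT; rewrite ltnn.
Qed.

Theorem theorem4p5 (Theta Theta' : penv) (P Q : process) (Delta : ltype)
    (rho : record) (Delta_rho Gamma : ctype) (p : pvar)
    (dP : typing Theta P Delta_rho)
    (dQ : typing Theta'.[p <- Delta] Q Gamma) :
  relabel Delta rho Delta_rho ->
  p \notin domf Theta' ->
  [disjoint domf Theta & domf Theta'] ->
  chop_free dP -> chop_free dQ ->
  exists (R : process) (dR : typing (Theta + Theta') R Gamma),
    chop_free dR.
Proof.
move=> rhoP pT' disT cP cQ.
have [P' [[dP' cP'] P'free]] := forward_all (ex_intro _ dP cP).
(* Both the free names of [P'] and the image of [rho] equal [domf Delta_rho]. *)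
have okP' : abs_ok rho P' by move=> z; case: rhoP => _ _ <- _.
(* [recv] adds its channel to [Gamma], so [x] must avoid it; [send] types its own channel alone, so
   [0] serves there. *)
have [x xG] := fresh (domf Gamma).
have [d cd] : chop_free_typable (Theta + Theta')
    (PCut (TSend Delta) (bindC 0 (PSend 0 (params rho) (bindR rho P')))
       (bindC x (PRecvP x (bindV p Q)))) ([fmap] + Gamma).
  apply: cut_chop_free => //; first exact: fdisjoint0X.
    by exists (ty_send 0 okP' rhoP dP').
  (* [dual (TSend Delta)] computes to [TRecv Delta]. *)
  by exists (ty_recv pT' xG dQ).
by rewrite cat0f in d cd *; exists _, d.
Qed.
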